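(* Let $\zeta$ be a uniform binary substitution. Then for every $y\in X_\zeta$ and every $m,\ell\in\mathbb N$, \[ \lim_{\varepsilon\to0}\mathrm{DET}_\ell(y^{(m)},\infty,\varepsilon)=1 . \]
   Context: Alphabet $A=\{0,1\}$, $\Sigma=A^{\mathbb N_0}$ with metric $\rho(y,z)=2^{-\min\{i\ge0:\,y_i\ne z_i\}}$ ($y\ne z$), shift $\sigma$. A uniform binary substitution is a map $\zeta:A\to A^*$ with $|\zeta(0)|=|\zeta(1)|=q\ge2$, extended to words by concatenation; $\mathcal L_\zeta$ is the set of subwords of words $\zeta^k(a)$, $a\in A$, $k\ge1$; $X_\zeta=\{y\in\Sigma:y_0\dots y_{n-1}\in\mathcal L_\zeta\ \forall n\}$. For a sequence $z$ (over a finite alphabet, analogous metric and shift), $\varepsilon>0$, $n\ge2$: recurrence plot $R(z,n,\varepsilon)$ is the $n\times n$ matrix ($0\le i,j<n$) with entry $1$ iff $\rho(\sigma^iz,\sigma^jz)\le\varepsilon$. A line of length $\ell$ is $(i,j,\ell)$ with $0\le i,j\le n-\ell$, $i\ne j$, entries $(i+k,j+k)=1$ for $0\le k<\ell$, entry $(i-1,j-1)=0$ if $\min\{i,j\}>0$, entry $(i+\ell,j+\ell)=0$ if $\max\{i,j\}<n-\ell$. $N_\ell$ = number of lines of length exactly $\ell$, $\lambda_\ell=N_\ell/(n^2-n)$, $\mathrm{RR}_\ell=\sum_{l\ge\ell}l\lambda_l$, determinism $\mathrm{DET}_\ell=\mathrm{RR}_\ell/\mathrm{RR}_1$; $\mathrm{DET}_\ell(z,\infty,\varepsilon)$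 is the limit as $n\to\infty$ (it exists in the situation of the claim). Embedding: $y^{(m)}$ is the sequence over $A^m$ whose $j$-th letter is $y_j\dots y_{j+m-1}$. *)

(* Defs.v *)
From HB Require Import structures.
From mathcomp Require Import all_boot all_order all_algebra.
From mathcomp Require Import all_classical all_reals all_analysis.
Set Implicit Arguments. Unset Strict Implicit. Unset Printing Implicit Defensive.
Import Order.TTheory GRing.Theory Num.Theory numFieldNormedType.Exports.
Local Open Scope ring_scope.
Local Open Scope classical_set_scope.

(** Binary alphabet A = {0,1} is modelled by [bool] (false = 0, true = 1). *)

Definition subst_word (zeta : bool -> seq bool) (w : seq bool) : seq bool :=
  flatten (map zeta w).

Definition subst_iter (zeta : bool -> seq bool) (k : nat) (w : seq bool) :=
  iter k (subst_word zeta) w.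

Definition uniform_subst (zeta : bool -> seq bool) (q : nat) : Prop :=
  (2 <= q)%N /\ size (zeta false) = q /\ size (zeta true) = q.

Definition in_lang (zeta : bool -> seq bool) (w : seq bool) : Prop :=
  exists (a : bool) (k : nat), (1 <= k)%N /\ infix w (subst_iter zeta k [:: a]).

Definition in_subshift (zeta : bool -> seq bool) (y : nat -> bool) : Prop :=
  forall n : nat, in_lang zeta (mkseq y n).

Definition shift {T : Type} (i : nat) (z : nat -> T) : nat -> T := fun k => z (i + k)%N.

Definition rho (R : realType) {T : eqType} (u v : nat -> T) : R :=
  match pselect (exists i, (fun i => u i != v i) i) with
  | left h => (2%:R : R) ^- (ex_minn h)
  | right _ => 0
  end.

Definition embed (m : nat) (y : nat -> bool) : nat -> m.-tuple bool :=
  fun j => [tuple y (j + k)%N | k < m].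

Definition rp (R : realType) {T : eqType} (z : nat -> T) (eps : R) (i j : nat) : bool :=
  rho R (shift i z) (shift j z) <= eps.

Definition is_line (R : realType) {T : eqType} (z : nat -> T) (n : nat) (eps : R)
    (i j l : nat) : bool :=
  [&& (i <= n - l)%N, (j <= n - l)%N, i != j,
      [forall k : 'I_l, rp z eps (i + k)%N (j + k)%N],
      (0 < minn i j)%N ==> ~~ rp z eps i.-1 j.-1 &
      (maxn i j < n - l)%N ==> ~~ rp z eps (i + l)%N (j + l)%N].

Definition Nlines (R : realType) {T : eqType} (z : nat -> T) (n : nat) (eps : R)
    (l : nat) : nat :=
  #|[set ij : 'I_n * 'I_n | is_line z n eps ij.1 ij.2 l]|.

Definition lambda (R : realType) {T : eqType} (z : nat -> T) (n : nat) (eps : R)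
    (l : nat) : R :=
  (Nlines z n eps l)%:R / ((n ^ 2)%:R - n%:R).

(** RR_l = sum_{l' >= l} l' lambda_{l'} (lines have length at most n). *)
Definition RR (R : realType) {T : eqType} (z : nat -> T) (n : nat) (eps : R)
    (l : nat) : R :=
  \sum_(l <= l' < n.+1) l'%:R * lambda z n eps l'.

Definition DET (R : realType) {T : eqType} (l : nat) (z : nat -> T) (n : nat)
    (eps : R) : R :=
  RR z n eps l / RR z n eps 1.

Definition DETinf (R : realType) {T : eqType} (l : nat) (z : nat -> T) (eps : R) : R :=
  lim ((fun n => DET l z n eps) @ \oo).

(* Main.v *)
Require Import Defs.
From HB Require Import structures.
From mathcomp Require Import all_boot all_order all_algebra zify ring lra.

(** For [eps < 1] the recurrence plot of [embed m y] compares windows of [y] of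
    some length [K], and [K] tends to infinity as [eps] tends to [0].  Let [s k] be
    the limiting proportion of pairs of positions of [y] at which the same word of
    length [k] starts.  Counting lines by inclusion-exclusion shows that the number
    of lines of length [l] is a second difference of numbers of runs, whence the
    determinism tends to [(l * s (K+l-1) - (l-1) * s (K+l)) / s K] as the size of
    the plot grows.  The same identity shows that [s] is convex.

    The limits [s k] exist because the frequency of a word is an almost additive
    function on the language: the difference of its values on the two words
    [zeta^p(a)] is multiplied by at most [q - 1], up to a bounded error, when [p]
    increases by one, while lengths are multiplied by [q].  The only exceptions are
    the substitutions permuting the constant words, for which [y] is constant.

    Applying [zeta] to pairs of equal words gives [s (k+1) <= q * s (q * k)].  With
    the convexity of [s] this forces [s k - s (k+1) = O(s k / k)], hence
    [s (k+1) / s k] tends to [1], and so does the determinism. *)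

Set Implicit Arguments. Unset Strict Implicit. Unset Printing Implicit Defensive.

(** * Runs in a square 0-1 matrix *)

Definition runs (E : rel nat) (n l : nat) : {set 'I_n * 'I_n} :=
  [set ij : 'I_n * 'I_n | [&& (ij.1 + l <= n)%N, (ij.2 + l <= n)%N
    & [forall k : 'I_l, E (ij.1 + k)%N (ij.2 + k)%N]]].

Definition maximal_runs (E : rel nat) (n l : nat) : {set 'I_n * 'I_n} :=
  [set ij in runs E n l |
    ((0 < minn ij.1 ij.2)%N ==> ~~ E ij.1.-1 ij.2.-1) &&
    ((maxn ij.1 ij.2 + l < n)%N ==> ~~ E (ij.1 + l)%N (ij.2 + l)%N)].

Lemma runsP (E : rel nat) n l (i j : 'I_n) :
  reflect [/\ (i + l <= n)%N, (j + l <= n)%N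
            & forall k, (k < l)%N -> E (i + k)%N (j + k)%N]
          ((i, j) \in runs E n l).
Proof.
rewrite inE /=; apply: (iffP and3P) => -[h1 h2].
  by move=> /forallP h; split=> // k kl; have := h (Ordinal kl).
by move=> h; split=> //; apply/forallP => k; apply: h.
Qed.

Lemma subset_runs (E : rel nat) n l : runs E n l.+1 \subset runs E n l.
Proof.
apply/subsetP => -[i j] /runsP[h1 h2 h]; apply/runsP; split; try lia.
by move=> k kl; apply: h; lia.
Qed.

Definition ord_dec n (i : 'I_n) : 'I_n :=
  Ordinal (leq_ltn_trans (leq_pred i) (ltn_ord i)).

Definition left_extendable_runs (E : rel nat) (n l : nat) :=
  [set ij in runs E n l | (0 < minn ij.1 ij.2)%N && E ij.1.-1 ij.2.-1].

Definition pair_dec n (ij : 'I_n * 'I_n) := (ord_dec ij.1, ord_dec ij.2).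

(** [ord_dec] sends both 0 and 1 to 0, so injectivity needs positive coordinates. *)
Lemma pair_dec_inj n :
  {in [pred ij : 'I_n * 'I_n | (0 < minn ij.1 ij.2)%N] &, injective (@pair_dec n)}.
Proof.
move=> -[i j] [i' j'] /=; rewrite !inE /= => h h' [e1 e2].
by congr pair; apply/val_inj => /=; lia.
Qed.

Lemma left_extendableP (E : rel nat) n l (i j : 'I_n) :
  reflect [/\ (i, j) \in runs E n l, (0 < i)%N, (0 < j)%N & E i.-1 j.-1]
          ((i, j) \in left_extendable_runs E n l).
Proof.
rewrite [X in reflect _ X]inE leq_min -andbA; exact: and4P.
Qed.

(** Moving the start one step back along the diagonal is a bijection onto the runs that are one
    longer. *)
Lemma card_left_extendable_runs (E : rel nat) n l : (0 < l)%N ->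
  #|left_extendable_runs E n l| = #|runs E n l.+1|.
Proof.
move=> l0; rewrite -(card_in_imset (f := @pair_dec n)); last first.
  by move=> ij ij' h h'; apply: pair_dec_inj;
    [move: h|move: h']; rewrite !inE => /and3P[].
apply: eq_card => -[i j]; apply/imsetP/idP.
  move=> [[i' j'] /left_extendableP[/runsP[h1 h2 h] i0 j0 e] -> /=].
  apply/runsP; rewrite /=; split; try lia.
  move=> [|k] kl; first by rewrite !addn0.
  by rewrite -!addSnnS !prednK //; apply: h.
move=> /runsP[h1 h2 h].
have hi : (i.+1 < n)%N by lia.
have hj : (j.+1 < n)%N by lia.
exists (Ordinal hi, Ordinal hj); last by congr pair; apply: val_inj.
apply/left_extendableP; split=> //=; last first.
  by have := h 0%N isT; rewrite !addn0.
apply/runsP; rewrite /=; split; try lia.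
by move=> k kl; rewrite !addSnnS; apply: h.
Qed.

Lemma card_both_extendable_runs (E : rel nat) n l : (0 < l)%N ->
  #|runs E n l.+1 :&: left_extendable_runs E n l| = #|runs E n l.+2|.
Proof.
move=> l0; rewrite -(@card_left_extendable_runs E n l.+1) //.
apply: eq_card => -[i j]; rewrite inE; apply/andP/left_extendableP.
  by move=> [h /left_extendableP[_ ? ? ?]].
move=> [h i0 j0 e]; split=> //; apply/left_extendableP; split=> //.
exact: (subsetP (subset_runs E n l)).
Qed.

(* Inclusion-exclusion: the runs of length [l] that are not maximal extend to
   the right or to the left, and those extending both ways are counted by
   their left extension, a run of length [l.+2]. *)
Lemma card_maximal_runs (E : rel nat) n l : (0 < l)%N ->
  (#|maximal_runs E n l| + 2 * #|runs E n l.+1| =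
   #|runs E n l| + #|runs E n l.+2|)%N.
Proof.
move=> l0.
pose U := runs E n l.+1 :|: left_extendable_runs E n l.
have sU : U \subset runs E n l.
  rewrite subUset subset_runs /=; apply/subsetP => ij.
  by rewrite inE => /andP[].
have -> : maximal_runs E n l = runs E n l :\: U.
  apply/setP => -[i j]; rewrite !in_setD !in_setU negb_or.
  rewrite [LHS]inE andbC; case: (boolP ((i, j) \in runs E n l)) => [r|_];
    last by rewrite !andbF.
  rewrite !andbT andbC /=; congr andb.
    have/runsP[h1 h2 h] := r.
    apply/idP/idP => [/implyP H|H].
      apply/negP => /runsP[g1 g2 g].
      by have /negP := H ltac:(lia); apply; apply: g.
    apply/implyP => H1; apply: contra H => e; apply/runsP; split; try lia.
    move=> k; rewrite ltnS leq_eqVlt => /orP[/eqP->//|]; exact: h.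
  by rewrite [in RHS]inE r /= negb_and; case: (0 < _)%N.
have := cardsID U (runs E n l); rewrite (setIidPr sU) => <-.
have := cardsUI (runs E n l.+1) (left_extendable_runs E n l).
rewrite card_both_extendable_runs // card_left_extendable_runs // -/U.
lia.
Qed.

Lemma runs_eq0 (E : rel nat) n l : (n < l)%N -> runs E n l = set0.
Proof.
move=> nl; apply/setP => -[i j]; rewrite in_set0; apply/negP => /runsP[]; lia.
Qed.

(** Summation by parts: downward induction on [l], starting beyond [n] where there are no runs, uses
    [l] times the identity of [card_maximal_runs] at each step. *)
Lemma sum_maximal_runs (E : rel nat) n l : (0 < l)%N ->
  (\sum_(l <= k < n.+1) k * #|maximal_runs E n k| + l.-1 * #|runs E n l.+1| =
   l * #|runs E n l|)%N.
Proof.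
move=> l0; have [d] := ubnP (n.+1 - l); elim: d l l0 => // d IH l l0 hd.
have [nl|ln] := ltnP n l.
  by rewrite big_geq // !runs_eq0 ?cards0 ?muln0 //; lia.
rewrite big_ltn //.
have := IH l.+1 isT; have := card_maximal_runs E n l0.
case: l l0 hd ln => // l _ hd ln /=.
set a := #|_|; set b := #|_|; set c := #|_|; set d' := #|_|; set S := \sum_(_ <= _ < _) _.
move=> e /(_ ltac:(lia)); nia.
Qed.

Lemma card_runs_convex (E : rel nat) n l : (0 < l)%N ->
  (2 * #|runs E n l.+1| <= #|runs E n l| + #|runs E n l.+2|)%N.
Proof. by move=> l0; rewrite -card_maximal_runs // leq_addl. Qed.

Lemma eq_runs (E E' : rel nat) n l :
  (forall i j, E i j = E' i j) -> runs E n l = runs E' n l.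
Proof.
move=> e; apply/setP => -[i j].
by apply/runsP/runsP => -[? ? h]; split=> // k /h; rewrite e.
Qed.

Definition offdiag (E : rel nat) i j := (i != j) && E i j.

(** Lines avoid the main diagonal, which carries only linearly many runs, negligible against
    [n ^ 2]. *)
Lemma card_runs_offdiag (E : rel nat) n l : (0 < l)%N -> (forall i, E i i) ->
  (#|runs (offdiag E) n l| + (n.+1 - l) = #|runs E n l|)%N.
Proof.
move=> l0 Er.
pose D := [set ij : 'I_n * 'I_n | ij.1 == ij.2].
have dE : #|runs E n l :&: D| = (n.+1 - l)%N.
  have dinj : injective (fun i : 'I_n => (i, i)) by move=> i j [].
  have -> : runs E n l :&: D = (fun i => (i, i)) @: [set i : 'I_n | (i + l <= n)%N].
    apply/setP => -[i j]; rewrite in_setI [_ \in D]inE /=; apply/andP/imsetP.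
      by move=> [/runsP[h _ _] /eqP <-]; exists i; rewrite ?inE.
    move=> [k]; rewrite inE => hk [-> ->]; split=> //.
    by apply/runsP; split=> //.
  rewrite card_imset // cardsE -[in RHS](card_ord (n.+1 - l)) -!sum1_card /=.
  rewrite [RHS](eq_bigl xpredT) // (big_ord_widen n (fun=> 1%N)); last by lia.
  by apply: eq_bigl => i; rewrite unfold_in /=; lia.
rewrite -(cardsID D (runs E n l)) dE addnC; congr addn.
apply: eq_card => -[i j]; rewrite in_setD [_ \in D]inE /=.
apply/runsP/andP => [[h1 h2 h]|[ij /runsP[h1 h2 h]]].
  split; first by have /andP[] := h 0%N l0; rewrite !addn0.
  by apply/runsP; split=> // k /h /andP[].
split=> // k kl; rewrite /offdiag h // andbT.
by apply: contra ij => /eqP e; apply/eqP/val_inj => /=; lia.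
Qed.

(** * Occurrences and recurrences in words *)

(** Starting positions stop before the end of [x], so that even the empty word occurs at most
    [size x] times. *)
Definition occ (w x : seq bool) : nat := (\sum_(i < size x) prefix w (drop i x))%N.

Definition agree (y : nat -> bool) : rel nat := fun i j => y i == y j.

Definition recurrences (x : seq bool) (k : nat) : nat :=
  #|runs (agree (nth false x)) (size x) k|.

Lemma occ_cons w a x : occ w (a :: x) = (prefix w (a :: x) + occ w x)%N.
Proof. by rewrite /occ big_ord_recl. Qed.

Lemma occ_le w x : (occ w x <= size x)%N.
Proof.
elim: x => [|a x IH]; first by rewrite /occ big_ord0.
by rewrite occ_cons /= -add1n leq_add // leq_b1.
Qed.

Lemma occ_cat_ge w x x' : (occ w x + occ w x' <= occ w (x ++ x'))%N.
Proof.
elim: x => [|a x IH]; first by rewrite /occ big_ord0.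
rewrite cat_cons !occ_cons -addnA leq_add // -cat_cons.
case h : (prefix w (a :: x)) => //; rewrite (prefix_trans h) //.
exact: prefix_prefix.
Qed.

(* Only occurrences crossing the junction, at most [size w] of them, are lost. *)
Lemma occ_cat_le w x x' :
  (occ w (x ++ x') <= occ w x + occ w x' + size w)%N.
Proof.
(* The minimum makes the induction work: a new first letter can create a crossing occurrence only
   while the left part is shorter than [w]. *)
suff: (occ w (x ++ x') <= occ w x + occ w x' + minn (size x) (size w))%N.
  by move/leq_trans; apply; rewrite leq_add2l geq_minr.
elim: x => [|a x IH]; first by rewrite /occ big_ord0 min0n addn0.
rewrite cat_cons !occ_cons -cat_cons.
have [h|h] := leqP (size w) (size (a :: x)); last first.
  by move: h IH (leq_b1 (prefix w ((a :: x) ++ x'))) => /=; lia.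
have -> : prefix w ((a :: x) ++ x') = prefix w (a :: x).
  by rewrite !prefixE takel_cat.
by move: h IH => /=; lia.
Qed.

Lemma prefix_dropP (w x : seq bool) i : (i < size x)%N ->
  reflect ((i + size w <= size x)%N /\
           forall t, (t < size w)%N -> nth false x (i + t) = nth false w t)
          (prefix w (drop i x)).
Proof.
move=> ix; rewrite prefixE; apply: (iffP eqP) => [e|[h e]].
  split; first by have := congr1 size e; rewrite size_take_min size_drop /=; lia.
  by move=> t tw; rewrite -[in RHS]e nth_take // nth_drop.
apply: (@eq_from_nth _ false) => [|t].
  by rewrite size_take_min size_drop /=; lia.
rewrite size_take_min size_drop /= => ht.
have tw : (t < size w)%N by lia.
by rewrite nth_take // nth_drop e.
Qed.

Lemma sum_occ2 k (x : seq bool) (i j : 'I_(size x)) :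
  (\sum_(w : k.-tuple bool) prefix w (drop i x) * prefix w (drop j x) =
   ((i, j) \in runs (agree (nth false x)) (size x) k))%N.
Proof.
case: (boolP (_ \in _)) => [/runsP[hi hj h]|/runsP h]; last first.
  rewrite big1 // => w _.
  case: prefix_dropP => // -[hi ei]; case: prefix_dropP => // -[hj ej].
  case: h; rewrite size_tuple in hi hj ei ej; split=> // t tk.
  by rewrite /agree ei // ej.
have sw : size (take k (drop i x)) == k.
  by rewrite size_take_min size_drop /=; lia.
rewrite (bigD1 (Tuple sw)) //= big1 => [|w /eqP wn].
  case: prefix_dropP => //=; rewrite (eqP sw).
    case: prefix_dropP => //=; rewrite (eqP sw) // => -[]; split=> // t tk.
    by rewrite nth_take // nth_drop; apply/eqP; rewrite eq_sym; exact: h.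
  by move=> -[]; split=> // t tk; rewrite nth_take // nth_drop.
case: (boolP (prefix w _)) => // p; case: wn; apply/val_inj => /=.
by move: p; rewrite prefixE size_tuple => /eqP.
Qed.

(** Grouping the pairs of positions by the word they share gives a sum of squares, which reduces
    limits of recurrence counts to limits of word frequencies. *)
Lemma recurrencesE x k :
  recurrences x k = (\sum_(w : k.-tuple bool) occ w x ^ 2)%N.
Proof.
rewrite /recurrences -sum1_card big_mkcond /=.
rewrite (eq_bigr (fun ij : 'I_(size x) * 'I_(size x) =>
   (\sum_(w : k.-tuple bool) prefix w (drop ij.1 x) * prefix w (drop ij.2 x))%N)).
  rewrite exchange_big /=; apply: eq_bigr => w _.
  by rewrite expnS expn1 /occ big_distrlr /= pair_bigA.
by move=> [i j] _; rewrite /= sum_occ2; case: (_ \in _).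
Qed.

Lemma sum_occ x k : (0 < k)%N ->
  (size x <= k + \sum_(w : k.-tuple bool) occ w x)%N.
Proof.
move=> k0; rewrite /occ exchange_big /=.
rewrite (eq_bigr (fun i : 'I_(size x) => ((i + k <= size x)%N : nat))); last first.
  move=> i _; rewrite (_ : (i + k <= size x)%N =
      ((i, i) \in runs (agree (nth false x)) (size x) k)).
    by rewrite -sum_occ2; apply: eq_bigr => w _; case: prefix.
  by apply/idP/runsP => [h|[]//]; split=> // t _; rewrite /agree.
rewrite -leq_subLR -[X in (X <= _)%N]card_ord -sum1_card.
rewrite [X in (X <= _)%N](eq_bigl xpredT) //.
rewrite (big_ord_widen (size x) (fun=> 1%N)) ?leq_subr // big_mkcond /=.
apply: leq_sum => i _; case: ifP => //; lia.
Qed.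

(** * Recurrences under a uniform substitution and in windows *)

Lemma size_subst_word zeta q u : (forall b, size (zeta b) = q) ->
  size (subst_word zeta u) = (size u * q)%N.
Proof.
by move=> hq; elim: u => //= a u IH; rewrite size_cat IH hq mulSn.
Qed.

Lemma nth_subst_word zeta q u i r : (forall b, size (zeta b) = q) ->
  (i < size u)%N -> (r < q)%N ->
  nth false (subst_word zeta u) (i * q + r) = nth false (zeta (nth false u i)) r.
Proof.
move=> hq; elim: u i => //= a u IH [|i] iu rq; rewrite nth_cat hq.
  by rewrite mul0n add0n rq.
by rewrite mulSn -addnA ltnNge leq_addr /= addKn IH.
Qed.

(* A recurrence of length [k.+1] between positions [i] and [j] of [u] yields [q]
   recurrences of length [q * k], at the positions [q * i + r] and [q * j + r]. *)
Lemma recurrences_subst zeta q u k : (forall b, size (zeta b) = q) ->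
  (q * recurrences u k.+1 <= recurrences (subst_word zeta u) (q * k))%N.
Proof.
move=> hq; rewrite /recurrences.
set N := size (subst_word zeta u).
have hN : N = (size u * q)%N by rewrite /N (size_subst_word _ hq).
have lt (i : 'I_(size u)) (r : 'I_q) : (i * q + r < N)%N.
  rewrite hN; apply: (@leq_trans (i.+1 * q)); last by rewrite leq_mul2r ltn_ord orbT.
  by rewrite mulSn addnC ltn_add2r.
pose f (t : 'I_q * ('I_(size u) * 'I_(size u))) : 'I_N * 'I_N :=
  (Ordinal (lt t.2.1 t.1), Ordinal (lt t.2.2 t.1)).
have finj : injective f.
  move=> [r [i j]] [r' [i' j']] [] e1 e2.
  have q0 : (0 < q)%N by exact: (leq_ltn_trans (leq0n r)).
  have er : r = r' :> nat.
    have := congr1 (modn^~ q) e1; rewrite !modnMDl !modn_small //.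
  have ei : i = i' :> nat.
    by apply/eqP; rewrite -(eqn_pmul2r q0); apply/eqP; lia.
  have ej : j = j' :> nat.
    by apply/eqP; rewrite -(eqn_pmul2r q0); apply/eqP; lia.
  by congr (_, (_, _)); apply: val_inj.
have -> : (q * #|runs (agree (nth false u)) (size u) k.+1|)%N =
    #|setX [set: 'I_q] (runs (agree (nth false u)) (size u) k.+1)|.
  by rewrite cardsX cardsT card_ord.
rewrite -(card_imset _ finj); apply: subset_leq_card; apply/subsetP => ij /imsetP.
move=> [[r [i j]]]; rewrite in_setX => /andP[_] /= /runsP[hi hj h] ->.
have rq := ltn_ord r.
have kq : ((i + k.+1) * q <= N)%N by rewrite hN leq_mul2r hi orbT.
have kq' : ((j + k.+1) * q <= N)%N by rewrite hN leq_mul2r hj orbT.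
apply/runsP; rewrite /=; split; try nia.
(* The letter at [i * q + r + t] lies in block [i + (r + t) %/ q]. The offset [r] may reach into one
   block more than [k], whence [k.+1] equal letters. *)
move=> t tk; rewrite /agree -!addnA (divn_eq (r + t) q) !addnA -!mulnDl.
have q0 : (0 < q)%N by lia.
have m := ltn_pmod (r + t) q0.
have d : ((r + t) %/ q < k.+1)%N by rewrite ltn_divLR //; nia.
rewrite !(nth_subst_word hq) //; try lia.
by rewrite (eqP (h _ d)).
Qed.

Lemma recurrences_mkseq y N k : recurrences (mkseq y N) k = #|runs (agree y) N k|.
Proof.
rewrite /recurrences size_mkseq; apply: eq_card => -[i j].
apply/runsP/runsP => -[hi hj h]; split=> // t tk; have := h t tk;
  by rewrite /agree !nth_mkseq //; lia.
Qed.

Definition windows_agree (K : nat) (y : nat -> bool) : rel nat :=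
  fun i j => [forall t : 'I_K, y (i + t)%N == y (j + t)%N].

(** Consecutive windows overlap, so agreeing windows merge into one common word; windows starting
    before [n] see [n + K] letters. *)
Lemma card_runs_windows K y n l :
  #|runs (windows_agree K.+1 y) n l.+1| = recurrences (mkseq y (n + K)) (K + l).+1.
Proof.
rewrite recurrences_mkseq.
pose f (ij : 'I_n * 'I_n) :=
  (widen_ord (leq_addr K n) ij.1, widen_ord (leq_addr K n) ij.2).
have finj : injective f.
  by move=> [i j] [i' j'] [e e']; congr pair; apply: val_inj.
rewrite -(card_imset _ finj); apply: eq_card => -[i j]; apply/imsetP/runsP.
  move=> [[i' j'] /runsP[hi hj h] [-> ->]] /=; split; try lia.
  (* Letter [t] is read in window [t - K], truncated at 0, at place [t - (t - K)]. *)
  move=> t tk; have tl : (t - K < l.+1)%N by lia.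
  have tK : (t - (t - K) < K.+1)%N by lia.
  have /forallP/(_ (Ordinal tK)) := h _ tl; rewrite /agree /= -!addnA.
  by rewrite subnKC // leq_subr.
move=> [hi hj h].
have hi' : (i < n)%N by lia.
have hj' : (j < n)%N by lia.
exists (Ordinal hi', Ordinal hj'); last by congr pair; apply: val_inj.
apply/runsP => /=; split; try lia.
move=> t tl; apply/forallP => s; rewrite -!addnA; apply: h.
by have := ltn_ord s; lia.
Qed.

(** * Cutting words of the language into blocks *)

Lemma subst_word_cat zeta u v :
  subst_word zeta (u ++ v) = subst_word zeta u ++ subst_word zeta v.
Proof. by rewrite /subst_word map_cat flatten_cat. Qed.

Lemma subst_iter_cat zeta p u v :
  subst_iter zeta p (u ++ v) = subst_iter zeta p u ++ subst_iter zeta p v.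
Proof.
by elim: p => //= p; rewrite /subst_iter /= => ->; rewrite subst_word_cat.
Qed.

Lemma subst_iterD zeta p r u :
  subst_iter zeta (p + r) u = subst_iter zeta p (subst_iter zeta r u).
Proof. exact: iterD. Qed.

Lemma subst_iterSr zeta p a :
  subst_iter zeta p.+1 [:: a] = subst_iter zeta p (zeta a).
Proof. by rewrite -addn1 subst_iterD {2}/subst_iter /subst_word /= cats0. Qed.

Lemma subst_iter_nil zeta p : subst_iter zeta p [::] = [::].
Proof. by elim: p => // p; rewrite /subst_iter /= => ->. Qed.

Lemma subst_iter_blocks zeta p v :
  subst_iter zeta p v = subst_word (fun b => subst_iter zeta p [:: b]) v.
Proof.
elim: v => [|b v IH]; first exact: subst_iter_nil.
by rewrite -cat1s subst_iter_cat IH subst_word_cat /subst_word /= cats0.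
Qed.

Lemma size_subst_iter zeta q p u : (forall b, size (zeta b) = q) ->
  size (subst_iter zeta p u) = (size u * q ^ p)%N.
Proof.
move=> hq; elim: p => [|p IH]; first by rewrite muln1.
by rewrite /subst_iter /= (size_subst_word _ hq) IH expnSr mulnA.
Qed.

Lemma prefix_subst_word f Q x V : (forall b : bool, size (f b) = Q) ->
  prefix x (subst_word f V) ->
  exists v u, x = subst_word f v ++ u /\ (size u <= Q)%N.
Proof.
move=> fQ; elim: V x => [|b V IH] x.
  by rewrite prefixs0 => /eqP ->; exists [::], [::].
have [xQ|Qx] := leqP (size x) Q; first by move=> _; exists [::], x.
rewrite prefixE => /eqP; rewrite /subst_word /= take_cat fQ ltnNge (ltnW Qx) /=.
move=> ex; have [|v [u [ev su]]] := IH (drop Q x).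
  by rewrite -{1}ex drop_size_cat // prefixE size_take_min -ex take_min take_size eqxx.
by exists (b :: v), u; split=> //=; rewrite -catA -ev -{1}ex -{2}ex drop_size_cat.
Qed.

(** Blocks before the occurrence are dropped by induction; then [x] is cut at the end of the block
    where it starts, and [prefix_subst_word] handles the rest. *)
Lemma infix_subst_word f Q x V : (forall b : bool, size (f b) = Q) ->
  infix x (subst_word f V) ->
  exists u v u', [/\ x = u ++ subst_word f v ++ u', (size u <= Q)%N & (size u' <= Q)%N].
Proof.
move=> fQ; elim: V => [|b V IH].
  by move=> /size_infix; rewrite leqn0 size_eq0 => /eqP ->; exists [::], [::], [::].
move=> /infixP[s [s' e]].
have [Qs|sQ] := leqP Q (size s).
  apply: IH; apply/infixP; exists (drop Q s), s'.
  have := congr1 (drop Q) e; rewrite /subst_word /= drop_size_cat // => ->.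
  rewrite drop_cat; case: ltnP => // h.
  have -> : Q = size s by apply/eqP; rewrite eqn_leq Qs h.
  by rewrite subnn drop0 drop_size.
have := congr1 (drop Q) e; rewrite /subst_word /= drop_size_cat //.
rewrite drop_cat ltnNge (ltnW sQ) /= => e'.
have [|v [u' [ev su]]] := @prefix_subst_word f Q (drop (Q - size s) x) V fQ.
  rewrite /subst_word e' drop_cat; case: ltnP => h; first exact: prefix_prefix.
  by rewrite drop_oversize // prefix0s.
exists (take (Q - size s) x), v, u'; split=> //.
  by rewrite -ev cat_take_drop.
by rewrite size_take_min (leq_trans (geq_minl _ _)) ?leq_subr.
Qed.

Lemma in_lang_blocks zeta q p x : (1 < q)%N -> (forall b, size (zeta b) = q) ->
  in_lang zeta x -> (q ^ p < size x)%N ->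
  exists u v u', [/\ x = u ++ subst_iter zeta p v ++ u',
    (size u <= q ^ p)%N & (size u' <= q ^ p)%N].
Proof.
move=> q1 hq [a [k [_ h]]] xp.
(* A word longer than [q ^ p] does not fit in a lower iterate, so the ambient word is an image under
   the [p]-th iterate. *)
have kp : (p <= k)%N.
  rewrite leqNgt; apply/negP => kp.
  have := leq_trans xp (size_infix h); rewrite (size_subst_iter _ _ hq) mul1n.
  by rewrite ltnNge leq_pexp2l // ltnW.
have hQ b : size (subst_iter zeta p [:: b]) = (q ^ p)%N.
  by rewrite (size_subst_iter _ _ hq) mul1n.
move: h; rewrite -(subnKC kp) subst_iterD subst_iter_blocks.
move=> /(infix_subst_word hQ)[u [v [u' [e ? ?]]]].
by exists u, v, u'; rewrite subst_iter_blocks.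
Qed.

(* Imported only here because its set notations shadow those of finite sets. *)
From mathcomp Require Import all_classical all_reals all_analysis.
Import Order.TTheory GRing.Theory Num.Theory numFieldNormedType.Exports.
Local Open Scope ring_scope.
Local Open Scope classical_set_scope.

(** * Word frequencies *)

Lemma archi_gt (R : realType) (a : R) : exists N, a < N%:R.
Proof. by exists (Num.bound `|a|); apply: le_lt_trans (ler_norm a) (archi_boundP _). Qed.

(** The excess [u p - e] is multiplied by at most [r] at each step, so it eventually falls below
    [e]. *)
Lemma affine_recursion_small (R : realType) (u : nat -> R) (r e : R) (P : nat) :
  0 <= r < 1 -> 0 < e ->
  (forall p, (P <= p)%N -> u p.+1 <= r * u p + (1 - r) * e) ->
  exists2 p, (P <= p)%N & u p <= 2 * e.
Proof.
move=> /andP[r0 r1] e0 hu.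
have H j : u (P + j)%N - e <= r ^+ j * `|u P - e|.
  elim: j => [|j IH]; first by rewrite addn0 expr0 mul1r ler_norm.
  rewrite addnS; have := hu _ (leq_addr j P).
  have := ler_wpM2l r0 IH; rewrite exprS -mulrA; lra.
have r1' : `|r| < 1 by rewrite ger0_norm.
have /cvgr0Pnorm_le/(_ e e0) [N _ /(_ N (leqnn N)) /=] := cvg_geometric `|u P - e| r1'.
rewrite normrM normr_id normrX (ger0_norm r0) mulrC => hN.
by exists (P + N)%N; rewrite ?leq_addr //; have := H N; lra.
Qed.

Definition almost_additive (R : realType) (F : seq bool -> R) (c : R) :=
  (forall x, 0 <= F x <= (size x)%:R) /\
  (forall x x', `|F (x ++ x') - (F x + F x')| <= c).

Section AlmostAdditive.
Variables (R : realType) (F : seq bool -> R) (c : R).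
Hypothesis hF : almost_additive F c.

Lemma almost_additive_nil : F [::] = 0.
Proof. by apply/eqP; rewrite eq_le andbC; have [/(_ [::])] := hF. Qed.

Lemma almost_additive_ge0 : 0 <= c.
Proof. by have [_ /(_ [::] [::])] := hF; apply: le_trans. Qed.

Lemma almost_additive_blocks f v :
  `|F (subst_word f v) - \sum_(b <- v) F (f b)| <= c * (size v)%:R.
Proof.
elim: v => [|b v IH]; first by rewrite big_nil almost_additive_nil subrr normr0 mulr0.
rewrite big_cons -cat1s subst_word_cat {1}/subst_word /= cats0 -natr1.
have := hF.2 (f b) (subst_word f v); move: IH; rewrite !ler_norml; lra.
Qed.

Lemma sum_letters (g : bool -> R) v :
  \sum_(b <- v) g b =
  (size v)%:R * g false + (count_mem true v)%:R * (g true - g false).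
Proof.
elim: v => [|b v IH]; first by rewrite big_nil !mul0r addr0.
rewrite big_cons IH /= -natr1 natrD.
by case: b => /=; ring.
Qed.

Variables (zeta : bool -> seq bool) (q : nat).
Hypothesis q1 : (1 < q)%N.
Hypothesis hq : forall b, size (zeta b) = q.

Let B p b := F (subst_iter zeta p [:: b]).
Let delta p := B p true - B p false.

(** The difference of the two counts is the eigenvalue other than [q] of the incidence matrix; the
    condition says that its modulus is less than [q]. *)
Definition contracting :=
  ((count_mem true (zeta true) < q + count_mem true (zeta false)) &&
   (count_mem true (zeta false) < q + count_mem true (zeta true)))%N.

(** Up to [c * q], [B p.+1 b] is [q * B p false] plus the number of ones in [zeta b] times
    [delta p]. The first term cancels in the difference, and the remaining integer factor has
    modulus at most [q - 1]. *)
Lemma delta_step : contracting -> forall p,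
  `|delta p.+1| <= (q%:R - 1) * `|delta p| + 2 * c * q%:R.
Proof.
move=> /andP[c1 c2] p.
have E b : `|B p.+1 b - (q%:R * B p false + (count_mem true (zeta b))%:R * delta p)| <= c * q%:R.
  rewrite /B subst_iterSr subst_iter_blocks.
  have := almost_additive_blocks (fun a => subst_iter zeta p [:: a]) (zeta b).
  by rewrite sum_letters hq.
have hd : `|((count_mem true (zeta true))%:R - (count_mem true (zeta false))%:R) * delta p|
    <= (q%:R - 1) * `|delta p|.
  rewrite normrM ler_wpM2r // ler_norml.
  move: c1 c2; rewrite -!(ltr_nat R) !natrD => c1 c2.
  have : (count_mem true (zeta true))%:R <= q%:R + (count_mem true (zeta false))%:R - 1 :> R.
    by rewrite lerBrDr natr1 -natrD ler_nat -(ltr_nat R) natrD.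
  have : (count_mem true (zeta false))%:R <= q%:R + (count_mem true (zeta true))%:R - 1 :> R.
    by rewrite lerBrDr natr1 -natrD ler_nat -(ltr_nat R) natrD.
  by move=> ? ?; apply/andP; split; lra.
have := E true; have := E false; move: hd; rewrite [delta p.+1]/delta.
rewrite !ler_norml => /andP[] ? ? /andP[] ? ? /andP[] ? ?.
by apply/andP; split; lra.
Qed.

(** Division by [q ^ p] turns [delta_step] into an affine recursion of ratio [(q - 1) / q]. *)
Lemma delta_small : contracting -> forall e, 0 < e ->
  exists p, `|delta p| + c <= e * (q ^ p)%:R.
Proof.
move=> hc e e0; have c0 := almost_additive_ge0.
have q0 : 0 < q%:R :> R by rewrite ltr0n; lia.
have q1' : 1 < q%:R :> R by rewrite ltr1n.
have qp p : 0 < (q ^ p)%:R :> R by rewrite ltr0n expn_gt0; lia.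
(* From [P] on, the additive error of [delta_step] is at most [e / 4 * q ^ p]; this also controls
   the summand [c] at the end. *)
have [P hP] := archi_gt (2 * c * q%:R / (e / 4)).
have hPp p : (P <= p)%N -> 2 * c * q%:R <= e / 4 * (q ^ p)%:R.
  move=> Pp; rewrite [leRHS]mulrC -ler_pdivrMr; last by lra.
  apply: (le_trans (ltW hP)); rewrite ler_nat (leq_trans Pp) // ltnW //.
  exact: ltn_expl.
pose u p := `|delta p| / (q ^ p)%:R.
have [|||p Pp up] := @affine_recursion_small R u ((q%:R - 1) / q%:R) (e / 4) P _ _ _.
- apply/andP; split; first by apply: divr_ge0; [lra|exact: ltW].
  by rewrite ltr_pdivrMr // mul1r ltrBlDr ltrDl.
- lra.
- move=> p Pp; rewrite /u; apply: (@le_trans _ _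
      (((q%:R - 1) * `|delta p| + e / 4 * (q ^ p)%:R) / (q ^ p.+1)%:R)).
    rewrite ler_pM2r ?invr_gt0 //; apply: le_trans (delta_step hc p) _.
    by rewrite lerD2l hPp.
  rewrite expnS natrM le_eqVlt; apply/orP; left; apply/eqP; field.
  by rewrite !gt_eqF.
exists p.
have : `|delta p| <= 2 * (e / 4) * (q ^ p)%:R by rewrite -ler_pdivrMr.
have := hPp _ Pp; nra.
Qed.

(** Each full block contributes [B p false] up to [|delta p| + c]. The two end pieces cost at most
    [q ^ p] each and their junctions [c] each. *)
Lemma frequency_in_language p e x : 0 < e -> in_lang zeta x ->
  `|delta p| + c <= e * (q ^ p)%:R -> (q ^ p < size x)%N ->
  `|F x - (size x)%:R * (B p false / (q ^ p)%:R)|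
    <= 2 * c + 2 * (q ^ p)%:R + e * (size x)%:R.
Proof.
move=> e0 lx he xQ; have c0 := almost_additive_ge0.
have [u [v [u' [ex su su']]]] := in_lang_blocks q1 hq lx xQ.
set Q : R := (q ^ p)%:R in he *.
have Q0 : 0 < Q by rewrite ltr0n expn_gt0; lia.
set Z := subst_iter zeta p v in ex.
have sx : (size x)%:R = (size u)%:R + (size v)%:R * Q + (size u')%:R :> R.
  by rewrite ex !size_cat /Z (size_subst_iter _ _ hq) !natrD natrM addrA.
have h1 := hF.2 u (Z ++ u'); have h2 := hF.2 Z u'; rewrite -ex in h1.
have hu := hF.1 u; have hu' := hF.1 u'.
have suQ : (size u)%:R <= Q by rewrite ler_nat.
have suQ' : (size u')%:R <= Q by rewrite ler_nat.
have hZ : `|F Z - ((size v)%:R * B p false + (count_mem true v)%:R * delta p)| <= c * (size v)%:R.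
  rewrite -sum_letters /Z subst_iter_blocks; exact: almost_additive_blocks.
set b := B p false / Q.
have bE : B p false = b * Q by rewrite /b divfK // gt_eqF.
have b01 : 0 <= b <= 1.
  have := hF.1 (subst_iter zeta p [:: false]).
  rewrite (size_subst_iter _ _ hq) mul1n -/(B p false) => /andP[l0 l1].
  apply/andP; split; first exact: divr_ge0 l0 (ltW Q0).
  by rewrite ler_pdivrMr // mul1r.
have hk : `|(count_mem true v)%:R * delta p| <= (size v)%:R * `|delta p|.
  by rewrite normrM normr_nat ler_wpM2r // ler_nat count_size.
have hv : (size v)%:R * `|delta p| + c * (size v)%:R <= e * ((size v)%:R * Q).
  rewrite [c * _]mulrC -mulrDr [e * _]mulrCA; exact: ler_wpM2l.
have hvx : e * ((size v)%:R * Q) <= e * (size x)%:R.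
  apply: ler_wpM2l; first exact: ltW.
  by rewrite sx -addrA addrCA lerDl addr_ge0.
have hb1 : 0 <= (size u)%:R * b <= Q.
  case/andP: b01 => b0 b1; rewrite mulr_ge0 //=.
  by apply: le_trans suQ; rewrite ler_piMr.
have hb2 : 0 <= (size u')%:R * b <= Q.
  case/andP: b01 => b0 b1; rewrite mulr_ge0 //=.
  by apply: le_trans suQ'; rewrite ler_piMr.
have -> : (size x)%:R * b = (size u)%:R * b + (size v)%:R * B p false + (size u')%:R * b.
  by rewrite sx bE; ring.
move: h1 h2 hu hu' hZ hb1 hb2 hk; rewrite !ler_norml.
move=> /andP[? ?] /andP[? ?] /andP[? ?] /andP[? ?] /andP[? ?] /andP[? ?] /andP[? ?] /andP[? ?].
by apply/andP; split; lra.
Qed.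

End AlmostAdditive.

(** Length tending to infinity inside the language. Prefixes of [y] and iterates of [zeta] both run
    along this filter, so a limit along it may be computed on either. *)
Definition long_words (zeta : bool -> seq bool) : set_system (seq bool) :=
  [set A | exists N, forall x, in_lang zeta x -> (N <= size x)%N -> A x].

Lemma uniform_substP zeta q : uniform_subst zeta q ->
  (1 < q)%N /\ forall b, size (zeta b) = q.
Proof. by move=> [q1 [hf ht]]; split=> // -[]. Qed.

Lemma in_lang_iter zeta p a : (0 < p)%N -> in_lang zeta (subst_iter zeta p [:: a]).
Proof. by move=> p0; exists a, p; split=> //; exact: infix_refl. Qed.

Lemma long_words_filter zeta q : uniform_subst zeta q -> ProperFilter (long_words zeta).
Proof.
move=> /uniform_substP[q1 hq]; split.
  move=> [N H]; apply: (H (subst_iter zeta N.+1 [:: false])).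
    exact: in_lang_iter.
  rewrite (size_subst_iter _ _ hq) mul1n ltnW // ltnW //; exact: ltn_expl.
split.
- by exists 0%N.
- move=> A A' [N H] [N' H']; exists (maxn N N') => x lx.
  by rewrite geq_max => /andP[Nx Nx']; split; [exact: H|exact: H'].
- by move=> A A' AA' [N H]; exists N => x lx Nx; apply: AA'; apply: H.
Qed.

Lemma mkseq_long_words zeta y : in_subshift zeta y ->
  mkseq y @ \oo `=>` long_words zeta.
Proof.
move=> hy A [N H]; exists N => // n /= Nn; apply: H; first exact: hy.
by rewrite size_mkseq.
Qed.

Lemma iter_long_words zeta q : uniform_subst zeta q ->
  (fun p => subst_iter zeta p [:: false]) @ \oo `=>` long_words zeta.
Proof.
move=> /uniform_substP[q1 hq] A [N H]; exists N.+1 => // p /= Np; apply: H.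
  by apply: in_lang_iter; case: p Np.
rewrite (size_subst_iter _ _ hq) mul1n (leq_trans (ltnW Np)) // ltnW //.
exact: ltn_expl.
Qed.

(** By [frequency_in_language], the frequencies of all long words lie in one ball of radius [e], so
    they form a Cauchy filter. *)
Lemma almost_additive_cvg (R : realType) (F : seq bool -> R) c zeta q :
  almost_additive F c -> uniform_subst zeta q -> contracting zeta q ->
  cvg ((fun x => F x / (size x)%:R) @ long_words zeta).
Proof.
move=> hF uz hc; have [q1 hq] := uniform_substP uz.
have PF := long_words_filter uz.
apply: cauchy_cvg; apply: cauchy_exP => e e0.
have e3 : 0 < e / 3 by lra.
have [p hp] := delta_small hF q1 hq hc e3.
exists (F (subst_iter zeta p [:: false]) / (q ^ p)%:R).
have [N hN] := archi_gt ((2 * c + 2 * (q ^ p)%:R) / (e / 3)).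
exists (maxn N (q ^ p).+1) => x lx; rewrite geq_max => /andP[Nx Qx].
have x0 : 0 < (size x)%:R :> R by rewrite ltr0n; lia.
have := frequency_in_language hF q1 hq e3 lx hp Qx.
have : 2 * c + 2 * (q ^ p)%:R <= e / 3 * (size x)%:R.
  rewrite [leRHS]mulrC -ler_pdivrMr //; apply: (le_trans (ltW hN)).
  by rewrite ler_nat.
rewrite /= -ball_normE /= distrC => h1 h2.
rewrite -[X in X - _](mulfK (lt0r_neq0 x0)) -mulrBl normrM normfV (gtr0_norm x0).
rewrite ltr_pdivrMr // [X in X - _]mulrC; apply: le_lt_trans h2 _.
have : 0 < e * (size x)%:R by rewrite mulr_gt0.
lra.
Qed.

Lemma occ_almost_additive (R : realType) w :
  almost_additive (fun x => (occ w x)%:R : R) (size w)%:R.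
Proof.
split=> [x|x x']; first by rewrite ler0n ler_nat occ_le.
rewrite -natrD ger0_norm ?subr_ge0 ?ler_nat ?occ_cat_ge //.
by rewrite lerBlDl -natrD ler_nat occ_cat_le.
Qed.

Definition density (R : realType) (k : nat) (x : seq bool) : R :=
  (recurrences x k)%:R / (size x)%:R ^+ 2.

Lemma densityE (R : realType) k x :
  density R k x = \sum_(w : k.-tuple bool) ((occ w x)%:R / (size x)%:R) ^+ 2.
Proof.
rewrite /density recurrencesE natr_sum mulr_suml.
by apply: eq_bigr => w _; rewrite natrX expr_div_n.
Qed.

Lemma density_cvg (R : realType) zeta q k :
  uniform_subst zeta q -> contracting zeta q ->
  cvg (density R k @ long_words zeta).
Proof.
move=> uz hc; have PF := long_words_filter uz.
apply: (@cvgP _ _ (\sum_(w : k.-tuple bool)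
   (lim ((fun x => (occ w x)%:R / (size x)%:R : R) @ long_words zeta)) ^+ 2)).
rewrite (_ : density R k = fun x => \sum_(w : k.-tuple bool)
   ((occ w x)%:R / (size x)%:R) ^+ 2); last first.
  by apply/funext => x; rewrite densityE.
apply: cvg_big => [|w _]; first exact: add_continuous.
rewrite expr2.
have h := almost_additive_cvg (occ_almost_additive R w) uz hc.
by apply: cvgM; exact: h.
Qed.

(** * Recurrence densities *)

(** The frequencies of the [M] words of length [k] sum to nearly 1, so their squares cannot all be
    small. *)
Lemma density_limit_gt0 (R : realType) zeta q (s : R) k : uniform_subst zeta q ->
  (0 < k)%N -> density R k @ long_words zeta --> s -> 0 < s.
Proof.
move=> uz k0 hs; have PF := long_words_filter uz.
set M : R := #|{: k.-tuple bool}|%:R.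
have M0 : 0 < M by rewrite ltr0n card_tuple expn_gt0 card_bool.
apply: (@lt_le_trans _ _ ((2 * M)^-1)); first by rewrite invr_gt0; lra.
apply: (cvgr_to_ge hs); exists (4 * k)%N => x _ kx.
have x0 : 0 < (size x)%:R :> R by rewrite ltr0n; lia.
have hsum : 3 / 4 <= \sum_(w : k.-tuple bool) (occ w x)%:R / (size x)%:R :> R.
  pose S := (\sum_(w : k.-tuple bool) occ w x)%N.
  rewrite -mulr_suml -natr_sum ler_pdivlMr // -[X in _ <= X%:R]/S.
  have : (size x <= k + S)%N := sum_occ x k0; rewrite -(ler_nat R) natrD.
  by move: kx; rewrite -(ler_nat R) natrM; lra.
rewrite densityE.
(* The square is bounded below by its tangent at [1 / M]. As the frequencies sum to at least 3/4,
   this leaves [3 / (2 * M) - 1 / M]. *)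
apply: (@le_trans _ _ (\sum_(w : k.-tuple bool)
   (2 * M^-1 * ((occ w x)%:R / (size x)%:R) - M^-1 ^+ 2))); last first.
  apply: ler_sum => w _; set a : R := _ / (size x)%:R.
  by have := sqr_ge0 (a - M^-1); rewrite sqrrB; lra.
rewrite big_split /= -mulr_sumr sumr_const -/M.
have -> : - M^-1 ^+ 2 *+ #|{: k.-tuple bool}| = - M^-1.
  by rewrite -mulr_natr -/M expr2 mulNr divfK // gt_eqF.
have : M^-1 * (3 / 4) <= M^-1 * \sum_(w : k.-tuple bool) ((occ w x)%:R / (size x)%:R).
  by rewrite ler_wpM2l // ltW // invr_gt0.
rewrite invfM; have : 0 < M^-1 by rewrite invr_gt0.
by lra.
Qed.

Lemma density_limit_decreasing (R : realType) zeta q (s s' : R) k : uniform_subst zeta q ->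
  density R k @ long_words zeta --> s -> density R k.+1 @ long_words zeta --> s' ->
  s' <= s.
Proof.
move=> uz hs hs'; have PF := long_words_filter uz.
rewrite -subr_ge0; apply: (cvgr_to_ge (cvgB hs hs')); apply: nearW => x.
rewrite /= subr_ge0 ler_wpM2r ?invr_ge0 ?sqr_ge0 // ler_nat.
exact: subset_leq_card (subset_runs _ _ _).
Qed.

Lemma density_limit_convex (R : realType) zeta q (s s1 s2 : R) k :
  uniform_subst zeta q -> (0 < k)%N ->
  density R k @ long_words zeta --> s -> density R k.+1 @ long_words zeta --> s1 ->
  density R k.+2 @ long_words zeta --> s2 -> s1 - s2 <= s - s1.
Proof.
move=> uz k0 hs hs1 hs2; have PF := long_words_filter uz.
rewrite -subr_ge0.
apply: (cvgr_to_ge (cvgB (cvgB hs hs1) (cvgB hs1 hs2))); apply: nearW => x /=.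
rewrite !fctE /density; set t := (_ ^+ 2)^-1.
have t0 : 0 <= t by rewrite invr_ge0 sqr_ge0.
have := card_runs_convex (agree (nth false x)) (size x) k0.
rewrite -/(recurrences x _) -/(recurrences x _) -/(recurrences x _).
rewrite -(ler_nat R) natrD natrM => /(ler_wpM2r t0); lra.
Qed.

(** From an iterate to its image, the count of [recurrences_subst] grows at least by the factor [q],
    and the squared length by [q ^ 2]. *)
Lemma density_limit_renormalization (R : realType) zeta q (s s' : R) k :
  uniform_subst zeta q ->
  density R k.+1 @ long_words zeta --> s -> density R (q * k) @ long_words zeta --> s' ->
  s <= q%:R * s'.
Proof.
move=> uz hs hs'; have [q1 hq] := uniform_substP uz.
have q0 : 0 < q%:R :> R by rewrite ltr0n; lia.
pose x p := subst_iter zeta p [:: false].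
have hx : x @ \oo `=>` long_words zeta by exact: iter_long_words uz.
have hx1 : (fun p => x p.+1) @ \oo `=>` long_words zeta.
  by move=> A /hx [N _ h]; exists N => // p /= Np; exact: (h p.+1 (leqW Np)).
have c1 : (fun p => density R k.+1 (x p)) @ \oo --> s := cvg_comp _ _ hx hs.
have c2 : (fun p => density R (q * k) (x p.+1)) @ \oo --> s' := cvg_comp _ _ hx1 hs'.
have c : (fun p => q%:R * density R (q * k) (x p.+1) - density R k.+1 (x p)) @ \oo
    --> q%:R * s' - s.
  by apply: cvgB c1; apply: cvgM c2; exact: cvg_cst.
rewrite -subr_ge0; apply: (cvgr_to_ge c).
apply: nearW => p; rewrite subr_ge0 /density.
have -> : x p.+1 = subst_word zeta (x p) by [].
rewrite (size_subst_word _ hq) natrM.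
have := recurrences_subst (x p) k hq.
rewrite -(ler_nat R) natrM; set a : R := (recurrences (x p) _)%:R.
set d : R := (recurrences (subst_word _ _) _)%:R => h.
have n0 : 0 < (size (x p))%:R :> R.
  by rewrite ltr0n (size_subst_iter _ _ hq) mul1n expn_gt0; lia.
set n : R := (size (x p))%:R in n0 *.
have -> : q%:R * (d / (n * q%:R) ^+ 2) = d / q%:R / n ^+ 2.
  by field; rewrite !gt_eqF.
by rewrite ler_wpM2r ?invr_ge0 ?sqr_ge0 // ler_pdivlMr // mulrC.
Qed.

(** * Convex sequences with a renormalization inequality *)

Section ConvexDecay.
Variables (R : realType) (q : nat) (s : nat -> R).
Hypothesis q1 : (1 < q)%N.
Hypothesis s_gt0 : forall k, 0 < s k.+1.
Hypothesis s_dec : forall k, s k.+2 <= s k.+1.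
Hypothesis s_conv : forall k, s k.+2 - s k.+3 <= s k.+1 - s k.+2.
Hypothesis s_ren : forall k, (0 < k)%N -> s k.+1 <= q%:R * s (q * k)%N.

Let D k := s k.+1 - s k.+2.

Lemma decrement_le k j : D (k + j) <= D k.
Proof.
elim: j => [|j IH]; first by rewrite addn0.
by rewrite addnS; apply: le_trans (s_conv _) IH.
Qed.

Lemma s_le k j : s (k + j).+1 <= s k.+1.
Proof.
elim: j => [|j IH]; first by rewrite addn0.
by rewrite addnS; apply: le_trans (s_dec _) IH.
Qed.

Lemma total_decrement_le k j : s k.+1 - s (k + j).+1 <= j%:R * D k.
Proof.
elim: j => [|j IH]; first by rewrite addn0 mul0r subrr.
rewrite addnS -natr1; have := decrement_le k j; rewrite {1}/D; lra.
Qed.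

Lemma total_decrement_ge k j : j%:R * D (k + j) <= s k.+1 - s (k + j).+1.
Proof.
elim: j => [|j IH]; first by rewrite addn0 mul0r subrr.
rewrite addnS -natr1; have h := s_conv (k + j).
have : j%:R * D (k + j).+1 <= j%:R * D (k + j) by rewrite ler_wpM2l.
rewrite /D in h IH *; lra.
Qed.

(* Convexity spreads the decrement at [k] over [k./2 .. k], and the
   renormalization inequality bounds [s] at [k./2] by a multiple of [s] at [k]. *)
Lemma decrement_small k : (k./2%:R - 2) * D k <= q%:R * s k.+1.
Proof.
have D0 : 0 <= D k by rewrite subr_ge0.
have [k4|k4] := ltnP k 4.
  have : k./2%:R <= 2 :> R by rewrite ler_nat; lia.
  have : 0 <= q%:R * s k.+1 by rewrite mulr_ge0 // ltW.
  nra.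
set i := k./2.+1.
have ik : (i <= k)%N by rewrite /i; lia.
have h1 := total_decrement_ge i (k - i); rewrite subnKC // in h1.
have h2 : s i.+1 <= q%:R * s k.+1.
  apply: (le_trans (s_ren (isT : 0 < i)%N)); rewrite ler_wpM2l //.
  have kqi : (k.+1 <= q * i)%N.
    apply: (@leq_trans (2 * i)); first by rewrite /i; lia.
    by rewrite leq_mul2r q1 orbT.
  by have := s_le k (q * i - k.+1); rewrite -addSn subnKC.
have h3 : k./2%:R - 2 <= (k - i)%:R :> R.
  by rewrite lerBlDr -natrD ler_nat /i; lia.
have := ler_wpM2r D0 h3; have := s_gt0 k; lra.
Qed.

(** Indices are shifted: this is the determinism for line length [l.+1] and window length [k.+1]. *)
Definition det_limit (l k : nat) : R :=
  (l.+1%:R * s (k + l).+1 - l%:R * s (k + l).+2) / s k.+1.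

(** The difference has numerator [l * D (k + l)] minus the total decrement from [k.+1] to
    [(k + l).+1]. Both lie between 0 and [l * D k], which [decrement_small] bounds. *)
Lemma det_limit_near1 l k : (6 <= k)%N ->
  `|det_limit l k - 1| <= l%:R * q%:R / (k./2%:R - 2).
Proof.
move=> k6; have sk := s_gt0 k.
have k2 : 0 < k./2%:R - 2 :> R by rewrite subr_gt0 ltr_nat; lia.
rewrite -[X in _ - X](divff (lt0r_neq0 sk)) -mulrBl normrM normfV (gtr0_norm sk).
rewrite ler_pdivrMr // [leRHS]mulrAC ler_pdivlMr //.
apply: (@le_trans _ _ (l%:R * D k * (k./2%:R - 2))); last first.
  by rewrite -!mulrA ler_wpM2l // mulrC decrement_small.
apply: ler_wpM2r; first exact: ltW.
rewrite ler_norml -natr1.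
have := total_decrement_le k l; have := s_le k l.
have : l%:R * D (k + l) <= l%:R * D k by rewrite ler_wpM2l // decrement_le.
have : 0 <= l%:R * D (k + l) by rewrite mulr_ge0 // subr_ge0.
rewrite {1 2}/D => ? ? ? ?; apply/andP; split; lra.
Qed.

End ConvexDecay.

(** * Determinism *)

Lemma subst_iter_nseq zeta q (g : bool -> bool) a k :
  (forall b, zeta b = nseq q (g b)) ->
  subst_iter zeta k [:: a] = nseq (q ^ k) (iter k g a).
Proof.
move=> hz; elim: k => // k IH; rewrite /subst_iter /= -/(subst_iter _ _ _) IH.
rewrite expnSr; elim: (q ^ k)%N => //= n IHn.
by rewrite /subst_word /= -/(subst_word _ _) IHn hz mulSn nseqD.
Qed.

(** Both counts lie between 0 and [q], so a difference of modulus at least [q] forces one image to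
    be all ones and the other all zeros. *)
Lemma not_contracting_nseq zeta q : (forall b, size (zeta b) = q) ->
  ~~ contracting zeta q -> exists g, forall b, zeta b = nseq q (g b).
Proof.
move=> hq; rewrite /contracting negb_and -!leqNgt.
have ct b : (count_mem true (zeta b) <= q)%N by rewrite -(hq b) count_size.
have all_true b : count_mem true (zeta b) = q -> zeta b = nseq q true.
  move=> h; rewrite -(hq b); apply/all_pred1P; rewrite all_count h hq //.
have all_false b : count_mem true (zeta b) = 0%N -> zeta b = nseq q false.
  move=> h; rewrite -(hq b); apply/all_pred1P/allP => -[] //= hb.
  by move/count_memPn: h; rewrite hb.
move=> /orP[h|h]; [exists id|exists negb]; case.
- by apply: all_true; have := ct true; lia.
- by apply: all_false; have := ct true; lia.
- by apply: all_false; have := ct false; lia.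
- by apply: all_true; have := ct false; lia.
Qed.

(* A noncontracting substitution permutes the constant words, so that [y] is
   constant and belongs to the subshift of a contracting substitution. *)
Lemma contracting_reduction zeta q y : uniform_subst zeta q -> in_subshift zeta y ->
  exists zeta', [/\ uniform_subst zeta' q, contracting zeta' q & in_subshift zeta' y].
Proof.
move=> uz hy; have [q1 hq] := uniform_substP uz.
have [hc|/(not_contracting_nseq hq)[g hg]] := boolP (contracting zeta q).
  by exists zeta.
have yc i : y i = y 0%N.
  have [a [k [_]]] := hy i.+1; rewrite (subst_iter_nseq _ _ hg) => /mem_infix h.
  have h' j : (j <= i)%N -> y j = iter k g a.
    move=> ji; have : y j \in mkseq y i.+1.
      by apply/mapP; exists j => //; rewrite mem_iota.
    by move/h; rewrite mem_nseq => /andP[_ /eqP].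
  by rewrite !h'.
exists (fun=> nseq q (y 0%N)); split.
- by rewrite /uniform_subst !size_nseq.
- by rewrite /contracting andbb -[X in (X < _)%N]add0n ltn_add2r; lia.
- move=> n; exists false, n.+1; split=> //.
  rewrite (@subst_iter_nseq _ q (fun=> y 0%N)) //=.
  apply/infixP; exists [::], (nseq (q ^ n.+1 - n) (y 0%N)).
  rewrite (_ : mkseq y n = nseq n (y 0%N)).
    rewrite -nseqD subnKC // ltnW // ltnW //; exact: ltn_expl.
  apply: (@eq_from_nth _ false); first by rewrite size_mkseq size_nseq.
  by move=> i; rewrite size_mkseq => ni; rewrite nth_mkseq // nth_nseq ni yc.
Qed.

(** * From the metric to windows *)

Lemma rho_le (R : realType) (T : eqType) (u v : nat -> T) (eps : R) h :
  0 < eps -> 2 ^- h <= eps -> (forall k, (k < h)%N -> eps < 2 ^- k) ->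
  (rho R u v <= eps) <-> (forall t, (t < h)%N -> u t = v t).
Proof.
move=> e0 he hmin; rewrite /rho; case: pselect => [ex|nex]; last first.
  split=> _; last exact: ltW.
  move=> t _; apply/eqP/negPn/negP => ht; apply: nex; by exists t.
case: ex_minnP => i hi imin; split=> [le t th|eq].
  apply/eqP/negPn/negP => ht.
  have : eps < 2 ^- i by apply: hmin; apply: leq_ltn_trans (imin _ ht) th.
  by rewrite ltNge le.
have hle : (h <= i)%N by rewrite leqNgt; apply/negP => ih; move/eqP: hi; apply; exact: eq.
by apply: le_trans he; rewrite lef_pV2 ?posrE ?exprn_gt0 // ler_weXn2l // ler1n.
Qed.

Lemma rp_embed (R : realType) (y : nat -> bool) m (eps : R) : (0 < m)%N ->
  0 < eps < 1 ->
  exists K, (forall M, eps < 2 ^- M -> (M <= K)%N) /\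
    forall i j, rp (embed m y) eps i j = windows_agree K.+1 y i j.
Proof.
move=> m0 /andP[e0 e1].
have exh : exists h, 2 ^- h <= eps.
  have [N hN] := archi_gt (eps^-1).
  exists N; rewrite -[leRHS]invrK lef_pV2 ?posrE ?exprn_gt0 ?invr_gt0 //.
  apply: (le_trans (ltW hN)); rewrite -natrX ler_nat ltnW //; exact: ltn_expl.
case: (ex_minnP exh) => h he hmin.
have hlt k : (k < h)%N -> eps < 2 ^- k.
  by move=> kh; rewrite ltNge; apply/negP => /hmin; rewrite leqNgt kh.
have h0 : (0 < h)%N.
  by rewrite lt0n; apply/eqP => h0; move: he; rewrite h0 expr0 invr1 leNgt e1.
(* The first [h] letters of the embedded sequence show [h + m - 1] letters of [y], and this number
   is [K.+1]. *)
exists (h.-1 + m.-1)%N; split.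
  move=> M hM; suff : (M < h)%N by lia.
  rewrite ltnNge; apply/negP => hM'.
  suff : 2 ^- M <= eps by rewrite leNgt hM.
  by apply: le_trans he; rewrite lef_pV2 ?posrE ?exprn_gt0 // ler_weXn2l // ler1n.
move=> i j; apply/idP/forallP => [/(rho_le _ _ e0 he hlt) H [t /= tK]|H].
  have th : (minn t h.-1 < h)%N by lia.
  have tm : (t - minn t h.-1 < m)%N by lia.
  have := congr1 (fun w => tnth w (Ordinal tm)) (H _ th).
  rewrite /shift /embed !tnth_mktuple /= -!addnA subnKC ?geq_minl // => ->.
  exact: eqxx.
apply/(rho_le _ _ e0 he hlt) => t th; apply: eq_from_tnth => k.
rewrite /shift /embed !tnth_mktuple -!addnA.
have tk : (t + k < (h.-1 + m.-1).+1)%N by have := ltn_ord k; lia.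
by have /eqP := H (Ordinal tk).
Qed.

(** * Lines, runs and the limit of the determinism *)

Lemma Nlines_maximal_runs (R : realType) (T : eqType) (z : nat -> T) n (eps : R) l :
  (0 < l <= n)%N ->
  Nlines z n eps l = #|maximal_runs (offdiag (rp z eps)) n l|.
Proof.
move=> /andP[l0 ln]; apply: eq_card => -[i j].
(* The set in [Nlines] is a classical one, so membership goes through [asbool]. *)
have -> : ((i, j) \in in_set [set ij : 'I_n * 'I_n | is_line z n eps ij.1 ij.2 l]) =
    is_line z n eps i j l by rewrite unfold_in /in_set asboolb.
rewrite !inE /= /is_line.
(* As [l <= n], the subtraction is not truncated. *)
have -> : (i <= n - l)%N = (i + l <= n)%N by lia.
have -> : (j <= n - l)%N = (j + l <= n)%N by lia.
have -> : (maxn i j < n - l)%N = (maxn i j + l < n)%N by lia.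
rewrite -!andbA; congr [&& _, _ & _]; rewrite !andbA; apply/idP/idP.
  move=> /andP[/andP[/andP[ij /forallP h]] h1 h2].
  apply/andP; split; [apply/andP; split|].
  - by apply/forallP => k; rewrite /offdiag h eqn_add2r ij.
  - by apply/implyP => /(implyP h1); rewrite /offdiag negb_and => ->; rewrite orbT.
  - by apply/implyP => /(implyP h2); rewrite /offdiag negb_and => ->; rewrite orbT.
move=> /andP[/andP[/forallP h h1] h2].
have ij : (i != j :> nat).
  by have := h (Ordinal l0); rewrite /offdiag eqn_add2r => /andP[].
apply/andP; split; [apply/andP; split; [apply/andP; split=> //|]|].
- by apply/forallP => k; have := h k => /andP[].
- apply/implyP => m0; have := implyP h1 m0; rewrite /offdiag negb_and negbK.
  by move=> /orP[/eqP e|//]; case/eqP: ij; lia.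
- apply/implyP => m0; have := implyP h2 m0; rewrite /offdiag negb_and negbK.
  by rewrite eqn_add2r (negPf ij).
Qed.

Lemma DET_runs (R : realType) (T : eqType) (z : nat -> T) n (eps : R) l :
  (1 < n)%N ->
  DET l.+1 z n eps =
    (l.+1%:R * #|runs (offdiag (rp z eps)) n l.+1|%:R
     - l%:R * #|runs (offdiag (rp z eps)) n l.+2|%:R)
    / #|runs (offdiag (rp z eps)) n 1|%:R.
Proof.
move=> n1.
have RRE k : RR z n eps k.+1 =
    (k.+1%:R * #|runs (offdiag (rp z eps)) n k.+1|%:R
     - k%:R * #|runs (offdiag (rp z eps)) n k.+2|%:R) / ((n ^ 2)%:R - n%:R).
  rewrite /RR /lambda; under eq_bigr do rewrite mulrA.
  rewrite -mulr_suml; congr (_ / _).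
  rewrite -[in X in X - _]natrM -(sum_maximal_runs (offdiag (rp z eps)) n (ltn0Sn k)).
  rewrite natrD /= natrM addrK natr_sum !big_nat; apply: eq_bigr => k' /andP[k1 k2].
  by rewrite natrM (@Nlines_maximal_runs R T z n eps k') //; lia.
(* At length 1 the second term has coefficient 0, and the common normalization [n ^ 2 - n]
   cancels. *)
rewrite /DET !RRE mul0r subr0 mul1r invf_div mulrA divfK //.
rewrite subr_eq0 eqr_nat; apply/eqP; nia.
Qed.

Lemma invn_cvg0 (R : realType) : (fun n => n%:R^-1 : R) @ \oo --> (0 : R).
Proof.
apply/cvgr0Pnorm_le => e e0; have [N hN] := archi_gt e^-1.
exists N => // n /= Nn.
have n0 : e^-1 < n%:R by apply: lt_le_trans hN _; rewrite ler_nat.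
rewrite ger0_norm ?invr_ge0 // -[leRHS]invrK lef_pV2 ?posrE ?invr_gt0 ?(ltW n0) //.
by apply: lt_trans n0; rewrite invr_gt0.
Qed.

Lemma runs_windows_cvg (R : realType) zeta y K l (s : R) : in_subshift zeta y ->
  density R (K + l).+1 @ long_words zeta --> s ->
  (fun n => #|runs (offdiag (windows_agree K.+1 y)) n l.+1|%:R / n%:R ^+ 2 : R) @ \oo
    --> s.
Proof.
move=> hy hs.
have wr i : windows_agree K.+1 y i i by apply/forallP => t.
have hK : (fun n => mkseq y (n + K)) @ \oo `=>` long_words zeta.
  move=> A /(mkseq_long_words hy)[N _ h]; exists N => // n /= Nn.
  exact: (h (n + K)%N (leq_trans Nn (leq_addr K n))).
have c1 : (fun n => density R (K + l).+1 (mkseq y (n + K))) @ \oo --> s :=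
  cvg_comp _ _ hK hs.
have c2 : (fun n => 1 + K%:R * n%:R^-1 : R) @ \oo --> (1 + K%:R * 0 : R).
  by apply: cvgD; [exact: cvg_cst|apply: cvgM; [exact: cvg_cst|exact: invn_cvg0]].
have c3 : (fun n => (n - l)%:R / n%:R ^+ 2 : R) @ \oo --> (0 : R).
  apply: (squeeze_cvgr _ (cvg_cst 0) (@invn_cvg0 R)).
  exists 1%N => // n /= n0; have n0' : 0 < n%:R :> R by rewrite ltr0n.
  apply/andP; split; first by rewrite divr_ge0 // sqr_ge0.
  rewrite ler_pdivrMr ?exprn_gt0 // expr2 mulKf ?gt_eqF // ler_nat; exact: leq_subr.
(* The factor [(1 + K / n) ^ 2] changes the normalization from [(n + K) ^ 2] to [n ^ 2]; the
   subtracted term removes the diagonal. *)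
have c : (fun n => density R (K + l).+1 (mkseq y (n + K)) *
    ((1 + K%:R * n%:R^-1) * (1 + K%:R * n%:R^-1)) - (n - l)%:R / n%:R ^+ 2) @ \oo
    --> s * ((1 + K%:R * 0) * (1 + K%:R * 0)) - 0.
  by apply: cvgB c3; apply: cvgM c1 _; exact: cvgM.
move: c; rewrite mulr0 addr0 !mulr1 subr0; apply: cvg_trans; apply: near_eq_cvg.
exists 1%N => // n /= n0; have n0' : 0 < n%:R :> R by rewrite ltr0n.
have nK : 0 < n%:R + K%:R :> R by rewrite ltr_pwDl.
rewrite /density size_mkseq -card_runs_windows -(card_runs_offdiag _ (ltn0Sn l) wr).
rewrite subSS !natrD; set a : R := #|_|%:R; set b : R := (n - l)%:R.
by field; rewrite !gt_eqF.
Qed.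

Unset Implicit Arguments.

Theorem theorem1p3 (R : realType) (zeta : bool -> seq bool) (q : nat)
    (hzeta : uniform_subst zeta q)
    (y : nat -> bool) (hy : in_subshift zeta y) (m l : nat)
    (hm : (1 <= m)%N) (hl : (1 <= l)%N) :
  (\forall eps \near (0 : R)^'+, cvg ((fun n => DET l (embed m y) n eps) @ \oo)) /\
  (fun eps : R => DETinf l (embed m y) eps) @ (0 : R)^'+ --> (1 : R).
Proof.
have [xi [uz hc {}hy]] := contracting_reduction hzeta hy.
have [q1 hq] := uniform_substP uz.
pose s k := lim (density R k @ long_words xi).
have hs k : density R k @ long_words xi --> s k by exact: density_cvg uz hc.
have s_gt0 k : 0 < s k.+1 by exact: density_limit_gt0 uz _ (hs k.+1).
have s_dec k : s k.+2 <= s k.+1 by exact: density_limit_decreasing uz (hs _) (hs _).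
have s_conv k : s k.+2 - s k.+3 <= s k.+1 - s k.+2.
  by exact: density_limit_convex uz _ (hs _) (hs _) (hs _).
have s_ren k : (0 < k)%N -> s k.+1 <= q%:R * s (q * k)%N.
  by move=> _; exact: density_limit_renormalization uz (hs _) (hs _).
(* From here on, [l] is the line length minus one. *)
case: l hl => // l _.
have det_cvg (eps : R) : 0 < eps < 1 -> exists K,
    (forall M, eps < 2 ^- M -> (M <= K)%N) /\
    (fun n => DET l.+1 (embed m y) n eps) @ \oo --> det_limit s l K.
  move=> e01; have [K [hK hrp]] := rp_embed y hm e01.
  exists K; split=> //.
  pose G j n : R := #|runs (offdiag (windows_agree K.+1 y)) n j.+1|%:R / n%:R ^+ 2.
  have hG j : G j @ \oo --> s (K + j).+1 by exact: runs_windows_cvg hy (hs _).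
  (* Numerator and denominator of [DET_runs] are both divided by [n ^ 2], so that each has a
     limit. *)
  have c : (fun n => (l.+1%:R * G l n - l%:R * G l.+1 n) / G 0%N n) @ \oo
      --> det_limit s l K.
    have hG0 := hG 0%N; have hG1 := hG l.+1; rewrite addn0 in hG0; rewrite addnS in hG1.
    apply: cvgM; last by apply: cvgV hG0; rewrite gt_eqF.
    apply: cvgB; first by apply: cvgM; [exact: cvg_cst|exact: hG].
    by apply: cvgM; [exact: cvg_cst|exact: hG1].
  apply: cvg_trans c; apply: near_eq_cvg; exists 2%N => // n /= n1.
  have n0 : 0 < n%:R :> R by rewrite ltr0n; lia.
  have eE i j : offdiag (rp (embed m y) eps) i j = offdiag (windows_agree K.+1 y) i j.
    by rewrite /offdiag hrp.
  rewrite DET_runs // !(eq_runs _ _ eE) /G.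
  rewrite mulrA [X in _ - X]mulrA -mulrBl invf_div mulrA divfK //.
  by rewrite expf_neq0 // gt_eqF.
have near01 : \forall eps \near (0 : R)^'+, 0 < eps < 1.
  near=> eps; apply/andP; split; near: eps.
    exact: nbhs_right_gt.
  by apply: nbhs_right_lt.
split.
  by apply: filterS near01 => eps /det_cvg[K [_ /cvgP]].
apply/cvgrPdist_le => e e0.
have [N hN] := archi_gt (l%:R * q%:R / e + 2).
(* [M <= K] gives both [6 <= K] and [N <= K./2], which bring the bound of [det_limit_near1] below
   [e]. *)
pose M := (N.*2 + 6)%N.
have M0 : 0 < 2 ^- M :> R by rewrite invr_gt0 exprn_gt0.
near=> eps.
have e01 : 0 < eps < 1 by near: eps.
have eM : eps < 2 ^- M by near: eps; apply: nbhs_right_lt.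
have [K [/(_ _ eM) MK /(cvg_lim (@Rhausdorff R))]] := det_cvg _ e01.
rewrite /DETinf => ->; rewrite distrC.
have K6 : (6 <= K)%N by rewrite (leq_trans _ MK) // leq_addl.
apply: (le_trans (det_limit_near1 q1 s_gt0 s_dec s_conv s_ren l K6)).
have K2 : l%:R * q%:R / e < K./2%:R - 2.
  rewrite ltrBrDr; apply: lt_le_trans hN _; rewrite ler_nat.
  by rewrite /M in MK; lia.
have K0 : 0 < K./2%:R - 2 :> R.
  by apply: le_lt_trans K2; rewrite divr_ge0 // ?mulr_ge0 // ltW.
by rewrite ler_pdivrMr // [leRHS]mulrC -ler_pdivrMr // ltW.
Unshelve. all: by end_near.
Qed.
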